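(* Let $G$ be a 3-edge-connected noncomplete graph. Then $pc(G)=2$, and there exists an edge-coloring $c$ of $G$ with 2 colors such that $G$ has the strong property under $c$.
   Context: All graphs are simple, finite and undirected. Let $G$ be a nontrivial connected graph with an edge-coloring $c:E(G)\to\{1,\dots,t\}$ (adjacent edges may receive the same color). A path in $G$ is called proper if no two consecutive edges of the path receive the same color (a single edge is a proper path). The colored graph is proper connected if every pair of distinct vertices is connected by at least one proper path. The proper connection number $pc(G)$ is the smallest number of colors in an edge-coloring of $G$ that makes $G$ proper connected. For an edge-colored path $P=v_1v_2\cdots v_s$ from $v_1$ to $v_s$, let $start(P)=c(v_1v_2)$ be the color of its first edge and $end(P)=c(v_{s-1}v_s)$ the color of its last edge (if $P$ is a single edge $v_1v_s$, then $start(P)=end(P)=c(v_1v_s)$). Let $c$ be an edge-coloring of $G$ that makes $G$ proper connected. $G$ has the strong property under $c$ if for any pair of distinct vertices $u,v\in V(G)$ there exist two proper paths $P_1,P_2$ from $u$ to $v$ (not necessarily disjoint) such that $start(P_1)\neq start(P_2)$ and $end(P_1)\neq end(P_2)$. *)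

(* Defs.v *)
From mathcomp Require Import all_boot.

Set Implicit Arguments.
Unset Strict Implicit.
Unset Printing Implicit Defensive.

Record graph := Graph {
  vertex :> finType;
  adj : rel vertex;
  adj_sym : symmetric adj;
  adj_irrefl : irreflexive adj }.

(* An edge is the two-element set of its ends. *)
Definition edges (G : graph) : {set {set G}} :=
  [set [set p.1; p.2] | p : G * G & adj p.1 p.2].

Definition connected (G : graph) : Prop := forall x y : G, connect (@adj G) x y.

Definition complete (G : graph) : Prop := forall x y : G, x != y -> adj x y.

Section DeleteEdges.
Variables (G : graph) (F : {set {set G}}).

Definition del_adj : rel G := fun x y => adj x y && ([set x; y] \notin F).

Fact del_adj_sym : symmetric del_adj.
Proof. by move=> x y; rewrite /del_adj adj_sym setUC. Qed.

Fact del_adj_irrefl : irreflexive del_adj.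
Proof. by move=> x; rewrite /del_adj adj_irrefl. Qed.

Definition del_edges : graph := Graph del_adj_sym del_adj_irrefl.

End DeleteEdges.

Definition edge_connected (k : nat) (G : graph) : Prop :=
  1 < #|G| /\
  forall F : {set {set G}}, F \subset edges G -> #|F| < k ->
    connected (del_edges F).

Section Coloring.
Variable G : graph.

(* The values of [c] outside [edges G] are irrelevant. *)
Definition edge_coloring (t : nat) (c : {set G} -> nat) : Prop :=
  {in edges G, forall f, 1 <= c f <= t}.

Variable c : {set G} -> nat.

(* As in [path], the vertex sequence u, p_1, ..., p_k is given by its first
   vertex [u] and the list [p] of the remaining ones. *)
Definition gpath (u v : G) (p : seq G) : bool :=
  [&& path (@adj G) u p, last u p == v & uniq (u :: p)].

Definition path_colors (u : G) (p : seq G) : seq nat :=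
  pairmap (fun x y => c [set x; y]) u p.

Definition proper_path (u v : G) (p : seq G) : bool :=
  gpath u v p && sorted (fun a b : nat => a != b) (path_colors u p).

(* The default 0 is returned only for the path with no edge. *)
Definition start_color (u : G) (p : seq G) : nat := head 0 (path_colors u p).
Definition end_color (u : G) (p : seq G) : nat := last 0 (path_colors u p).

Definition proper_connected : Prop :=
  forall u v : G, u != v -> exists p, proper_path u v p.

Definition strong_property : Prop :=
  proper_connected /\
  forall u v : G, u != v ->
    exists p1 p2 : seq G,
      [/\ proper_path u v p1, proper_path u v p2,
          start_color u p1 != start_color u p2 &
          end_color u p1 != end_color u p2].

End Coloring.

Definition proper_connectable (G : graph) (t : nat) : Prop :=
  exists c : {set G} -> nat, edge_coloring t c /\ proper_connected c.

(* [is_pc G n] means pc(G) = n. *)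
Definition is_pc (G : graph) (n : nat) : Prop :=
  proper_connectable G n /\ forall t, proper_connectable G t -> n <= t.

(* Main.v *)
(**
   A bipartition maximizing the number of crossing edges keeps at least half of
   every edge cut of G, for otherwise moving the cut side S across would improve
   it.  As the cuts of G have at least 3 edges, those of the spanning bipartite
   subgraph H of crossing edges have at least 2, so H has a strongly connected
   orientation (Robbins).  Colour an edge of H by the side of its tail.  Then
   every directed path of H, read in either direction, is proper; a directed path
   from u to v and the reversal of a directed path from v to u have different
   start colours and different end colours.
*)
Require Import Defs.
From mathcomp Require Import all_boot.

Set Implicit Arguments.
Unset Strict Implicit.
Unset Printing Implicit Defensive.

(** * Cuts, strong orientations and maximum bipartitions *)

Section DirectedCuts.
Variable V : finType.
Implicit Types (r h : rel V) (S A : {set V}).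

Definition cut r S : {set V * V} :=
  [set p | [&& r p.1 p.2, p.1 \in S & p.2 \notin S]].

(** No arc leaves the set of vertices reachable from [x], so this set is everything. *)
Lemma cut_neq0_connect r :
  (forall S, S != set0 -> S != setT -> cut r S != set0) ->
  forall x y, connect r x y.
Proof.
move=> rcut x y; set S := [set z | connect r x z].
have xS : x \in S by rewrite inE.
have [ST|nST] := eqVneq S setT; first by have := in_setT y; rewrite -ST inE.
have nS0 : S != set0 by apply/set0Pn; exists x.
have /set0Pn[[a b]] := rcut S nS0 nST.
rewrite !inE /= => /and3P[rab xa /negP[]].
exact: connect_trans xa (connect1 rab).
Qed.

(* Start from h itself and delete opposite arcs as long as strong connectivity
   survives.  If neither (u, v) nor (v, u) can be deleted, they are the only arcs
   leaving some S and some T; then no arc leaves S :&: T or S :|: T, so S and T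
   are complementary and uv is a bridge. *)
Lemma strong_orientation h : irreflexive h ->
  (forall S, S != set0 -> S != setT -> 1 < #|cut h S|) ->
  exists r, [/\ subrel r h, forall x y, r x y -> ~~ r y x
              & forall x y, connect r x y].
Proof.
move=> h_irr hcut.
pose rel_of (R : {set V * V}) : rel V := fun x y => (x, y) \in R.
pose strong R := [forall S, (S != set0) ==> (S != setT) ==> (cut (rel_of R) S != set0)].
(* Keeping at least one direction of every arc of [h] allows cuts of [R] to bound cuts of [h] at the
   end. *)
pose covers (R : {set V * V}) :=
  [forall p, h p.1 p.2 ==> (p \in R) || ((p.2, p.1) \in R)].
pose P (R : {set V * V}) := [&& R \subset [set p | h p.1 p.2], covers R & strong R].
have Ph : P [set p | h p.1 p.2].
  apply/and3P; split; first exact: subxx.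
    by apply/forallP => p; apply/implyP => hp; rewrite inE hp.
  apply/forallP => S; apply/implyP => S0; apply/implyP => ST.
  have /card_gt0P[[x y]] := ltnW (hcut S S0 ST).
  by rewrite inE => xy; apply/set0Pn; exists (x, y); rewrite inE /rel_of inE.
have [R /minsetP[/and3P[Rh Rcov Rstr] Rmin] _] := minset_exists Ph.
have RhE x y : (x, y) \in R -> h x y.
  by move=> Rxy; have := subsetP Rh _ Rxy; rewrite inE.
have RcovE x y : h x y -> ((x, y) \in R) || ((y, x) \in R).
  by move=> hxy; have := forallP Rcov (x, y); rewrite hxy.
have cutP S : S != set0 -> S != setT -> exists x y,
    [/\ (x, y) \in R, x \in S & y \notin S].
  move=> S0 ST; have := forallP Rstr S; rewrite S0 ST => /set0Pn[[x y]].
  by rewrite inE => /and3P[? ? ?]; exists x, y.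
(* Without [(a, b)] the set still covers [h], thanks to [(b, a)]; by minimality it must then fail to
   be strong. *)
have tight a b : (a, b) \in R -> (b, a) \in R -> exists S,
    [/\ a \in S, b \notin S
      & forall x y, (x, y) \in R -> x \in S -> y \notin S -> (x, y) = (a, b)].
  move=> Rab Rba.
  have nab : (a == b) = false.
    by apply/eqP => eab; have := RhE _ _ Rab; rewrite eab h_irr.
  have Dsub : R :\ (a, b) \subset R := subD1set _ _.
  have covD : covers (R :\ (a, b)).
    apply/forallP => -[x y]; apply/implyP => /RcovE; rewrite !inE /=.
    have [[-> ->] _|_ /=] := eqVneq (x, y) (a, b).
      by rewrite Rba andbT xpair_eqE eq_sym nab.
    have [[-> ->] _|_ //] := eqVneq (y, x) (a, b).
    by rewrite Rba.
  have /forallPn[S] : ~~ strong (R :\ (a, b)).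
    apply/negP => strD.
    have PD : P (R :\ (a, b)) by rewrite /P covD strD (subset_trans Dsub Rh).
    by have := Rab; rewrite -(Rmin _ PD Dsub) !inE eqxx.
  rewrite 2!negb_imply negbK => /and3P[S0 ST /eqP cutS0].
  have onlyS x y : (x, y) \in R -> x \in S -> y \notin S -> (x, y) = (a, b).
    move=> Rxy xS yS; apply/eqP; apply: contraT => nxy.
    have : (x, y) \in cut (rel_of (R :\ (a, b))) S.
      by rewrite inE /rel_of /= xS yS !andbT in_setD1 nxy.
    by rewrite cutS0 inE.
  have [x [y [Rxy xS yS]]] := cutP S S0 ST.
  have [ex ey] := onlyS x y Rxy xS yS.
  by exists S; rewrite -ex -ey; split=> // x' y'; rewrite ex ey; exact: onlyS.
exists (rel_of R); split.
- by move=> x y; exact: RhE.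
- move=> u v Ruv; apply/negP => Rvu.
  have [S [uS vS onlyS]] := tight _ _ Ruv Rvu.
  have [T [vT uT onlyT]] := tight v u Rvu Ruv.
  have ST0 : S :&: T = set0.
    apply/eqP/negPn/negP => nI0.
    have IT : S :&: T != setT.
      by apply/eqP => /setP/(_ u); rewrite !inE (negPf uT) andbF.
    have [x [y [Rxy]]] := cutP _ nI0 IT.
    rewrite inE => /andP[xS xT]; rewrite inE negb_and => /orP[yS|yT].
      by have [ex _] := onlyS _ _ Rxy xS yS; rewrite -ex xT in uT.
    by have [ex _] := onlyT _ _ Rxy xT yT; rewrite -ex xS in vS.
  have STT : S :|: T = setT.
    apply/eqP/negPn/negP => nUT.
    have U0 : S :|: T != set0 by apply/set0Pn; exists u; rewrite inE uS.
    have [x [y [Rxy]]] := cutP _ U0 nUT.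
    rewrite !inE negb_or => /orP[xS|xT] /andP[yS yT].
      by have [_ ey] := onlyS _ _ Rxy xS yS; rewrite ey vT in yT.
    by have [_ ey] := onlyT _ _ Rxy xT yT; rewrite ey uS in yS.
  have TE z : (z \in T) = (z \notin S).
    have := in_setT z; have := in_set0 z; rewrite -ST0 -STT !inE.
    by case: (z \in S); case: (z \in T).
  have S0 : S != set0 by apply/set0Pn; exists u.
  have SnT : S != setT by apply: contraNneq vS => ->; rewrite inE.
  (* If only the reverse of an arc leaving [S] is in [R], that reverse leaves [T], the complement of
     [S], and hence is [(v, u)]. *)
  have : cut h S \subset [set (u, v)].
    apply/subsetP => -[x y]; rewrite inE /= => /and3P[/RcovE/orP[Rxy|Ryx] xS yS].
      by rewrite (onlyS x y Rxy xS yS) set11.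
    have yT : y \in T by rewrite TE.
    have xT : x \notin T by rewrite TE xS.
    by have [-> ->] := onlyT y x Ryx yT xT; rewrite set11.
  by move/subset_leq_card; rewrite cards1 leqNgt (hcut S S0 SnT).
- apply: cut_neq0_connect => S S0 ST.
  have [x [y [Rxy xS yS]]] := cutP S S0 ST.
  by apply/set0Pn; exists (x, y); rewrite inE /= xS yS /rel_of Rxy.
Qed.

Definition crossing r A : rel V := fun x y => r x y && ((x \in A) != (y \in A)).

Lemma crossing_cut_ge_half r : symmetric r ->
  exists A, forall S, #|cut r S| <= #|cut (crossing r A) S|.*2.
Proof.
move=> r_sym.
pose D A := [set p : V * V | crossing r A p.1 p.2].
have [A _ Amax] := @arg_maxnP {set V} set0 predT (fun A => #|D A|) isT.
exists A => S.
(* Moving [S] across toggles crossing exactly for the pairs in [X], those separated by [S]. *)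
pose A' := [set x | (x \in A) (+) (x \in S)].
pose X := [set p : V * V | (p.1 \in S) != (p.2 \in S)].
pose E := [set p : V * V | r p.1 p.2].
(* [X] contains both orders of each separated pair, while [cut] keeps only the one leaving [S]. *)
have double (q : rel V) : symmetric q -> #|[set p | q p.1 p.2] :&: X| = #|cut q S|.*2.
  move=> q_sym; rewrite -addnn.
  pose sw (p : V * V) := (p.2, p.1).
  have sw_inj : injective sw by move=> [a b] [a' b'] [-> ->].
  rewrite -{2}(card_imset (mem (cut q S)) sw_inj) -(cardsID [set p | p.1 \in S]).
  congr (_ + _); apply: eq_card => -[x y].
    by rewrite !inE /=; case: (q x y); case: (x \in S); case: (y \in S).
  apply/idP/imsetP.
    rewrite !inE /= => /and3P[xS qxy yS]; exists (y, x) => //.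
    by rewrite inE /= q_sym qxy xS; move: xS yS; case: (x \in S); case: (y \in S).
  move=> [[a b]]; rewrite !inE /= => /and3P[qab aS bS] [-> ->].
  by rewrite q_sym qab aS (negPf bS).
have cr_sym : symmetric (crossing r A).
  by move=> x y; rewrite /crossing r_sym eq_sym.
have le_mono : #|(E :\: D A) :&: X| <= #|D A :&: X|.
  have := Amax A' isT; rewrite /= -(cardsID X (D A)) -(cardsID X (D A')).
  have -> : D A' :\: X = D A :\: X.
    apply/setP => -[x y]; rewrite !inE /crossing !inE /=.
    by case: (r x y); case: (x \in A); case: (y \in A); case: (x \in S); case: (y \in S).
  have -> : D A' :&: X = (E :\: D A) :&: X.
    apply/setP => -[x y]; rewrite !inE /crossing !inE /=.
    by case: (r x y); case: (x \in A); case: (y \in A); case: (x \in S); case: (y \in S).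
  by rewrite leq_add2r.
(* Counted in ordered pairs, the edges in [X] split into crossing and non-crossing ones, and
   [le_mono] bounds the latter by the former. *)
rewrite -(double _ cr_sym) -/(D A) -leq_double -(double _ r_sym) -/E.
rewrite -(cardsID (D A) (E :&: X)) -addnn leq_add //.
  by apply: subset_leq_card; apply/subsetP => p; rewrite !inE => /andP[/andP[_ ->] ->].
by apply: leq_trans le_mono; rewrite setIDAC.
Qed.

End DirectedCuts.

(** * Reversal of proper paths *)

Section ReversedPaths.
Variables (G : graph) (c : {set G} -> nat).
Implicit Types (u v : G) (p : seq G).

(** As [u :: p] is [rcons (belast u p) (last u p)], the reversed path has first vertex [last u p]
    and remaining vertices [rev (belast u p)]. *)
Lemma path_colors_rev u p :
  path_colors c (last u p) (rev (belast u p)) = rev (path_colors c u p).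
Proof.
rewrite /path_colors; elim: p u => //= y p IH u.
rewrite rev_cons -cats1 pairmap_cat IH rev_cons -cats1 /=.
congr (_ ++ [:: c _]); rewrite setUC; congr (_ |: [set _]).
by case: p {IH} => //= z p; rewrite rev_cons last_rcons.
Qed.

Lemma last_rev_belast u p : last (last u p) (rev (belast u p)) = u.
Proof. by case: p => //= z p; rewrite rev_cons last_rcons. Qed.

Lemma proper_path_rev u v p :
  proper_path c u v p -> proper_path c v u (rev (belast u p)).
Proof.
case/andP => /and3P[pp /eqP <- up] sp; apply/andP; split; last first.
  rewrite path_colors_rev rev_sorted.
  by under eq_sorted do rewrite eq_sym.
apply/and3P; split.
- by rewrite rev_path; under eq_path do rewrite adj_sym.
- by rewrite last_rev_belast.
- by rewrite -rev_rcons -lastI rev_uniq.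
Qed.

Lemma start_color_rev u p :
  start_color c (last u p) (rev (belast u p)) = end_color c u p.
Proof.
rewrite /start_color /end_color path_colors_rev.
by case/lastP: (path_colors c u p) => // s x; rewrite rev_rcons last_rcons.
Qed.

Lemma end_color_rev u p :
  end_color c (last u p) (rev (belast u p)) = start_color c u p.
Proof.
rewrite /start_color /end_color path_colors_rev.
by case: (path_colors c u p) => // x s; rewrite rev_cons last_rcons.
Qed.

End ReversedPaths.

(** * Colouring by the side of the tail *)

Section TailColoring.
Variables (G : graph) (A : {set G}) (r : rel G).
Hypothesis r_crossing : subrel r (crossing (@adj G) A).
Hypothesis r_anti : forall x y, r x y -> ~~ r y x.
Hypothesis r_strong : forall x y, connect r x y.

Definition side (x : G) : nat := if x \in A then 1 else 2.

(** An edge is an unordered pair, so its tail has to be recovered by a search among the arcs of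
    [r]. *)
Definition tail_coloring (f : {set G}) : nat :=
  if [exists p : G * G, [&& r p.1 p.2, p.1 \in A & f == [set p.1; p.2]]]
  then 1 else 2.

(** When [x] is outside [A], an arc out of [A] on the same edge could only be [(y, x)], which
    [r_anti] excludes. *)
Lemma tail_coloringE x y : r x y -> tail_coloring [set x; y] = side x.
Proof.
move=> rxy; rewrite /tail_coloring /side.
have [xA|xA] := boolP (x \in A).
  by case: ifP => // /existsP[]; exists (x, y); rewrite rxy xA eqxx.
case: existsP => // -[[a b] /= /and3P[rab aA /eqP exy]].
have /andP[_ ab_cross] := r_crossing rab.
have bA : b \notin A by move: ab_cross; rewrite aA; case: (b \in A).
have : b \in [set x; y] by rewrite exy !inE eqxx orbT.
have : a \in [set x; y] by rewrite exy !inE eqxx.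
have yA : y \in A.
  by have /andP[_] := r_crossing rxy; rewrite (negPf xA); case: (y \in A).
rewrite !inE => /orP[/eqP ea|/eqP ea]; first by rewrite -ea aA in xA.
case/orP=> /eqP eb; last by rewrite eb yA in bA.
by move: rab; rewrite ea eb (negPf (r_anti rxy)).
Qed.

Lemma side_neq x y : r x y -> side x != side y.
Proof.
move/r_crossing => /andP[_]; rewrite /side.
by case: (x \in A); case: (y \in A).
Qed.

Lemma directed_path_colors u p : path r u p ->
  path_colors tail_coloring u p = map side (belast u p).
Proof.
by elim: p u => //= y p IH u /andP[ruy /IH]; rewrite /path_colors /= => ->;
  rewrite tail_coloringE.
Qed.

Lemma directed_path_proper u p : path r u p -> uniq (u :: p) ->
  proper_path tail_coloring u (last u p) p.
Proof.
move=> rp up; rewrite /proper_path /gpath up eqxx !andbT; apply/andP; split.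
  by apply: sub_path rp => x y /r_crossing/andP[].
rewrite directed_path_colors //; elim: p u rp {up} => //= y p IH u /andP[ruy rp].
by case: p IH rp => //= z p IH rp; rewrite side_neq //; exact: IH rp.
Qed.

Lemma directed_start_color u p : path r u p -> p != [::] ->
  start_color tail_coloring u p = side u.
Proof. by case: p => // y p rp _; rewrite /start_color directed_path_colors. Qed.

(** The last edge takes the side of the penultimate vertex, opposite to that of the last one. *)
Lemma directed_end_color_neq u p : path r u p -> p != [::] ->
  end_color tail_coloring u p != side (last u p).
Proof.
case/lastP: p => // p y; rewrite rcons_path last_rcons => /andP[rp rly] _.
rewrite /end_color directed_path_colors ?rcons_path ?rp //.
by rewrite belast_rcons map_cons last_cons last_map side_neq.
Qed.

Lemma tail_coloring_bounds : edge_coloring 2 tail_coloring.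
Proof. by move=> f _; rewrite /tail_coloring; case: ifP. Qed.

Lemma directed_path_exists u v : u != v ->
  exists p, [/\ path r u p, uniq (u :: p), last u p = v & p != [::]].
Proof.
move=> nuv; have /connectP[p rp ev] := r_strong u v.
move: nuv; rewrite ev; case/shortenP: rp => p' rp' up' _ nuv.
by exists p'; split=> //; apply: contraNneq nuv => ->.
Qed.

Lemma tail_coloring_strong : strong_property tail_coloring.
Proof.
split=> u v nuv.
  have [p [rp up <- _]] := directed_path_exists nuv.
  by exists p; exact: directed_path_proper.
have [p [rp up ep p0]] := directed_path_exists nuv.
have nvu : v != u by rewrite eq_sym.
have [q [rq uq eq q0]] := directed_path_exists nvu.
(* At [u], [p] has colour [side u] and the reversed [q] has the other colour; at [v], the reversed
   [q] has colour [side v] and [p] the other. *)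
exists p, (rev (belast v q)); split.
- by rewrite -ep; exact: directed_path_proper.
- by apply: proper_path_rev; rewrite -eq; exact: directed_path_proper.
- rewrite -{2}eq start_color_rev (directed_start_color (u := u)) // eq_sym -eq.
  exact: directed_end_color_neq.
- rewrite -{2}eq end_color_rev (directed_start_color (u := v)) // -ep.
  exact: directed_end_color_neq.
Qed.

End TailColoring.

(** * Edge-connectivity as a bound on cuts, and the lower bound on colours *)

Lemma mem_edges (G : graph) (x y : G) : adj x y -> [set x; y] \in edges G.
Proof. by move=> xy; apply/imsetP; exists (x, y); rewrite ?inE. Qed.

Lemma edge_connected_cut k (G : graph) (S : {set G}) : edge_connected k G ->
  S != set0 -> S != setT -> k <= #|cut (@adj G) S|.
Proof.
move=> [_ Gk] /set0Pn[x xS] ST; rewrite leqNgt; apply/negP => small.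
have [y yS] : exists y, y \notin S.
  apply/existsP; rewrite -negb_forall; apply: contra ST => /forallP allS.
  by apply/eqP/setP => z; rewrite inE allS.
pose F := [set [set p.1; p.2] | p in cut (@adj G) S].
have FE : F \subset edges G.
  apply/subsetP => f /imsetP[p]; rewrite inE => /and3P[pe _ _] ->.
  exact: mem_edges.
have Fk : #|F| < k := leq_ltn_trans (leq_imset_card _ _) small.
have /connectP[p pp ey] := Gk F FE Fk x y.
(* Once the edges of the cut are deleted, a path starting in [S] never leaves it. *)
move: pp ey; elim: p x xS => [x xS _ ey|z p IH x xS /= /andP[/andP[xz xzF] zp] ey].
  by rewrite ey xS in yS.
apply: (IH z) => //; apply: contraNT xzF => zS.
by apply/imsetP; exists (x, z); rewrite // inE /= xz xS zS.
Qed.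

(** With at most one colour, a proper path has a single edge, so distinct vertices would all be
    adjacent. *)
Lemma noncomplete_proper_connectable_ge2 (G : graph) t :
  ~ complete G -> proper_connectable G t -> 1 < t.
Proof.
move=> ncG [c [ct cpc]]; rewrite ltnNge; apply/negP => t1.
apply: ncG => x y nxy; have [p /andP[/and3P[pp /eqP ey _] sp]] := cpc x y nxy.
case: p pp ey sp => [_ ey|z [|w p]]; first by rewrite -ey eqxx in nxy.
  by rewrite /= andbT => xz <-.
rewrite /= => /and3P[xz zw _] _ /andP[+ _].
have one a b : adj a b -> c [set a; b] = 1.
  move=> /mem_edges/ct/andP[c1 c2].
  by apply/eqP; rewrite eqn_leq c1 (leq_trans c2 t1).
by rewrite !one.
Qed.

Theorem theorem3p1 (G : graph) :
  edge_connected 3 G -> ~ complete G ->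
  is_pc G 2 /\
  exists c : {set G} -> nat, edge_coloring 2 c /\ strong_property c.
Proof.
move=> G3 ncG.
have [A Ahalf] := crossing_cut_ge_half (@adj_sym G).
have H_irr : irreflexive (crossing (@adj G) A).
  by move=> x; rewrite /crossing adj_irrefl.
have Hcut S : S != set0 -> S != setT -> 1 < #|cut (crossing (@adj G) A) S|.
  (* Twice the crossing cut is at least 3, which rules out the sizes 0 and 1. *)
  move=> S0 ST; have := leq_trans (edge_connected_cut G3 S0 ST) (Ahalf S).
  by case: #|_| => [|[]].
have [r [r_cross r_anti r_strong]] := strong_orientation H_irr Hcut.
have strong := tail_coloring_strong r_cross r_anti r_strong.
have bounds := tail_coloring_bounds A r.
split; last by exists (tail_coloring A r).
split; first by exists (tail_coloring A r); split=> //; case: strong.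
by move=> t; exact: noncomplete_proper_connectable_ge2.
Qed.
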